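(* Let $\Xi$ be the canonical transversal of the tiling space of a primitive, aperiodic substitution tiling of $\mathbb{R}^d$ ($d\ge1$) with finite local complexity, equipped with its ultrametric $\rho$. Then $\Xi$ is bi-Lipschitz embeddable in $\mathbb{R}^{d+1}$; that is, there exist a map $F:\Xi\to\mathbb{R}^{d+1}$ and constants $0<c_-\le c_+$ such that $c_-\rho(T,T')\le\|F(T)-F(T')\|\le c_+\rho(T,T')$ for all $T,T'\in\Xi$.
   Context: Substitution tilings of $\mathbb{R}^d$: let $\mathcal{A}$ be a finite set of prototiles, each a compact subset of $\mathbb{R}^d$ homeomorphic to a closed ball, containing the origin in its interior, and possibly carrying a label (to distinguish prototiles of the same shape). A tile is a translate $p+x$ of a prototile $p$ (keeping its label), and $x$ is called its puncture. A patch is a set of tiles with pairwise disjoint interiors; a tiling is a patch whose tiles cover $\mathbb{R}^d$. A substitution with expansion factor $\lambda>1$ assigns to each $p\in\mathcal{A}$ a finite patch $\omega(p)$ whose tiles have union $\lambda p$; it is extended to tiles by $\omega(p+x)=\omega(p)+\lambda x$, and to patches by taking unions, so iterates $\omega^n(p)$ are defined. The tiling space $\Omega$ is the set of tilings all of whose finite subpatches are, up to translation, contained in some $\omega^n(p)$, $n\in\mathbb{N}$, $p\in\mathcal{A}$. The substitution is primitive if there is $n$ such that, for all $p,q\in\mathcal{A}$, $\omega^n(q)$ contains a translate of $p$. Finite local complexity: for every $R>0$, the tilings of $\Omega$ contain, up to translation, only finitely many patches of diameter at most $R$. Aperiodic: no $T\in\Omega$ satisfies $T+x=T$ for a nonzero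 $x\in\mathbb{R}^d$. The canonical transversal is $\Xi=\{T\in\Omega:\ 0\text{ is the puncture of a tile of }T\}$. Its ultrametric is $\rho(T,T)=0$ and, for $T\ne T'$, $\rho(T,T')=1/(1+R)$, where $R$ is the supremum of all $r\ge0$ such that $T$ and $T'$ have exactly the same tiles meeting the closed ball of radius $r$ centred at $0$ (with $R=0$ if there is no such $r$). *)

(* Defs.v *)
From HB Require Import structures.
From mathcomp Require Import all_boot all_order all_algebra.
From mathcomp Require Import all_classical all_reals all_analysis.
Import Order.TTheory GRing.Theory Num.Theory.
Import numFieldNormedType.Exports.

Set Implicit Arguments.
Unset Strict Implicit.
Unset Printing Implicit Defensive.

Local Open Scope classical_set_scope.
Local Open Scope ring_scope.

(* The library norm on row vectors is the sup norm; balls, diameters and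
   bi-Lipschitz bounds below are Euclidean. *)
Definition enorm (R : realType) (n : nat) (x : 'rV[R]_n) : R :=
  Num.sqrt (\sum_(i < n) x ord0 i ^+ 2).

Definition eball (R : realType) (n : nat) (r : R) : set 'rV[R]_n :=
  [set x | enorm x <= r].

Definition homeomorphic (X Y : topologicalType) (A : set X) (B : set Y) : Prop :=
  exists (f : X -> Y) (g : Y -> X),
    [/\ {within A, continuous f}, {within B, continuous g},
        (forall x, A x -> B (f x)) /\ (forall y, B y -> A (g y)),
        (forall x, A x -> g (f x) = x) & (forall y, B y -> f (g y) = y)].

(* Prototiles are named by a finite type; the name plays the role of the label,
   so two prototiles with equal shapes are still distinct. *)
Record prototiles (R : realType) (d : nat) := Prototiles {
  prototile :> finType;
  proto_shape : prototile -> set 'rV[R]_d;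
  proto_compact : forall p, compact (proto_shape p);
  proto_ball : forall p, homeomorphic (proto_shape p) (@eball R d 1);
  proto_origin : forall p, interior (proto_shape p) 0
}.

Section Tilings.
Context {R : realType} {d : nat} {A : prototiles R d}.

(* The pair (p, x) is the tile p + x. *)
Definition tile : Type := (A * 'rV[R]_d)%type.

Definition puncture (t : tile) : 'rV[R]_d := t.2.

Definition tile_support (t : tile) : set 'rV[R]_d :=
  [set y + puncture t | y in proto_shape t.1].

Definition patch_support (P : set tile) : set 'rV[R]_d :=
  \bigcup_(t in P) tile_support t.

Definition translate (x : 'rV[R]_d) (P : set tile) : set tile :=
  [set (t.1, t.2 + x) | t in P].

Definition is_patch (P : set tile) : Prop :=
  forall s t, P s -> P t -> s <> t ->
    interior (tile_support s) `&` interior (tile_support t) = set0.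

Definition is_tiling (T : set tile) : Prop :=
  is_patch T /\ patch_support T = setT.

Definition diam_le (P : set tile) (r : R) : Prop :=
  forall y z, patch_support P y -> patch_support P z -> enorm (y - z) <= r.

Definition agree_on_ball (T T' : set tile) (r : R) : Prop :=
  [set t | T t /\ tile_support t `&` eball r !=set0] =
  [set t | T' t /\ tile_support t `&` eball r !=set0].

(* For T <> T' the set of radii is bounded above, and sup set0 = 0. *)
Definition rho (T T' : set tile) : R :=
  if `[< T = T' >] then 0
  else 1 / (1 + sup [set r | 0 <= r /\ agree_on_ball T T' r]).

End Tilings.

Arguments tile {R d} A.

Record substitution (R : realType) (d : nat) (A : prototiles R d) := Substitution {
  expansion : R;
  rule : A -> set (tile A);
  expansion_gt1 : 1 < expansion;
  rule_finite : forall p, finite_set (rule p);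
  rule_patch : forall p, is_patch (rule p);
  rule_support : forall p,
    patch_support (rule p) = [set expansion *: y | y in proto_shape p]
}.

Section SubstitutionTilings.
Context {R : realType} {d : nat} {A : prototiles R d} (w : substitution A).

Definition subst_patch (P : set (tile A)) : set (tile A) :=
  \bigcup_(t in P) translate (expansion w *: t.2) (rule w t.1).

Definition subst_iter (n : nat) (p : A) : set (tile A) :=
  iter n subst_patch [set (p, 0)].

Definition tiling_space : set (set (tile A)) :=
  [set T | is_tiling T /\
    forall P, P `<=` T -> finite_set P ->
      exists n p x, translate x P `<=` subst_iter n p].

Definition primitive : Prop :=
  exists n, forall p q : A, exists x, subst_iter n q (p, x).

Definition finite_local_complexity : Prop :=
  forall r : R, 0 < r ->
    exists S : set (set (tile A)), finite_set S /\
      forall T P, tiling_space T -> P `<=` T -> diam_le P r ->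
        exists Q x, S Q /\ P = translate x Q.

Definition aperiodic : Prop :=
  ~ exists T x, [/\ tiling_space T, x <> 0 & translate x T = T].

Definition canonical_transversal : set (set (tile A)) :=
  [set T | tiling_space T /\ exists2 t, T t & puncture t = 0].

End SubstitutionTilings.

(* Main.v *)
(**
Idea. If T and T + x coincide near 0 up to distance r, with |x| small compared
to r, then x = 0: by primitivity and finite local complexity every local
pattern of level-k supertiles, lambda^k being comparable to r, recurs inside
that ball, which makes T globally x-periodic. Hence, once its r-patch is known,
a point of Xi is determined up to radius L r by the pattern of supertiles of
size about L r around 0 (finitely many up to translation) and by the cell, in
a grid of mesh about r, containing a reference puncture of that pattern. This
leaves at most C L^d refinements, with C independent of L and r. Since C L^d is
at most (L/4)^(d+1) for large L, the nested partitions of Xi according to the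
patches of radius L^n are encoded by base-L digits below L/4 in each of d+1
coordinates, and the resulting expansions define the embedding.
*)
Require Import Defs.
From mathcomp Require Import all_boot all_order all_algebra.
From mathcomp Require Import all_classical all_reals all_analysis.
From mathcomp Require Import ring lra.
Import Order.TTheory GRing.Theory Num.Theory.
Import numFieldNormedType.Exports.

Set Implicit Arguments.
Unset Strict Implicit.
Unset Printing Implicit Defensive.

Local Open Scope classical_set_scope.
Local Open Scope ring_scope.

(** * Comparison of the sup norm and the Euclidean norm *)

Section RowVectors.
Context {R : realType} {n : nat}.
Implicit Types x y : 'rV[R]_n.

Lemma row_normE x : `|x| = \big[Num.max/0]_ij `|x ij.1 ij.2|.
Proof. exact: mx_normrE. Qed.

Lemma normr_coord x i : `|x ord0 i| <= `|x|.
Proof.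
rewrite row_normE.
exact: (le_bigmax _ (fun ij : 'I_1 * 'I_n => `|x ij.1 ij.2|) (ord0, i)).
Qed.

Lemma normr_row_le x e : 0 <= e -> (forall i, `|x ord0 i| <= e) -> `|x| <= e.
Proof.
move=> e0 xe; rewrite row_normE.
by apply: bigmax_le => // -[i j] _ /=; rewrite (ord1 i).
Qed.

Lemma enorm_coord x i : `|x ord0 i| <= enorm x.
Proof.
rewrite -sqrtr_sqr /enorm ler_wsqrtr// (bigD1 i)//= lerDl sumr_ge0// => j _.
exact: sqr_ge0.
Qed.

Lemma enorm_ge0 x : 0 <= enorm x.
Proof. exact: sqrtr_ge0. Qed.

Lemma normr_le_enorm x : `|x| <= enorm x.
Proof. by apply: normr_row_le (enorm_ge0 x) _ => i; exact: enorm_coord. Qed.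

(** The sharp factor is the square root of [n]; the cruder [n] suffices for bi-Lipschitz
    constants. *)
Lemma enorm_le_coord x e :
  0 <= e -> (forall i, `|x ord0 i| <= e) -> enorm x <= n%:R * e.
Proof.
move=> e0 xe; have ne0 : 0 <= n%:R * e by rewrite mulr_ge0.
rewrite -(ger0_norm ne0) -sqrtr_sqr /enorm ler_wsqrtr//.
apply: (@le_trans _ _ (\sum_(i < n) e ^+ 2)).
  by apply: ler_sum => i _; rewrite -real_normK ?num_real// lerXn2r ?nnegrE.
rewrite sumr_const card_ord -[_ *+ n]mulr_natl exprMn ler_wpM2r ?sqr_ge0//.
by rewrite -natrX ler_nat; case: (n) => // m; rewrite expnS leq_pmulr.
Qed.

Lemma enorm_le_normr x : enorm x <= n%:R * `|x|.
Proof. by apply: enorm_le_coord => // i; exact: normr_coord. Qed.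

Lemma interior_row (B : set 'rV[R]_n) x :
  interior B x <-> exists2 e, 0 < e & forall y, `|y - x| < e -> B y.
Proof.
rewrite /interior/= -filter_from_norm_nbhs.
by split=> -[e e0 eB]; exists e => // y xy; apply: eB;
  by move: xy; rewrite /ball_/= distrC.
Qed.

End RowVectors.


(** Induction on the list: either [O] lies in the first closed set, or the part of [O] outside it is
    open, nonempty and covered by the remaining sets. *)
Lemma finite_closed_cover (X : topologicalType) (I : eqType) (s : seq I)
    (C : I -> set X) (O : set X) :
  (forall i, i \in s -> closed (C i)) -> open O -> O !=set0 ->
  (forall y, O y -> exists2 i, i \in s & C i y) ->
  exists2 i, i \in s & interior (C i) `&` O !=set0.
Proof.
elim: s O => [|j s IHs] O Ccl Oo [y0 Oy0] OC; first by have [] := OC y0 Oy0.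
have [OCj|OnCj] := pselect (O `<=` C j).
  exists j; first by rewrite inE eqxx.
  by exists y0; split => //; move: OCj; rewrite open_subsetE// => /(_ _ Oy0).
have [] := IHs (O `&` ~` C j).
- by move=> i si; apply: Ccl; rewrite inE si orbT.
- by apply: openI => //; apply: closed_openC; apply: Ccl; rewrite inE eqxx.
- by move/existsNP: OnCj => [y /not_implyP[Oy nCy]]; exists y.
- move=> y [Oy nCy]; have [i] := OC y Oy.
  by rewrite inE => /predU1P[->//|si Ciy]; exists i.
- move=> i si [y [Ciy [Oy _]]]; exists i; first by rewrite inE si orbT.
  by exists y.
Qed.

(** * Grid cells in a cube *)

Section Grid.
Context {R : realType} {n : nat}.

(** [inord] only makes the index total; it is faithful on the cube [|x| <= B] once
    [2 * B / h < G.+1]. *)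
Definition cell (G : nat) (B h : R) (x : 'rV[R]_n) : {ffun 'I_n -> 'I_G.+1} :=
  [ffun i => inord (Num.trunc ((x ord0 i + B) / h))].

Lemma inord_trunc_close (G : nat) (B h a b : R) :
  0 < h -> 2 * B / h < G.+1%:R -> `|a| <= B -> `|b| <= B ->
  inord (Num.trunc ((a + B) / h)) = inord (Num.trunc ((b + B) / h)) :> 'I_G.+1 ->
  `|a - b| <= h.
Proof.
move=> h0 BG aB bB /(congr1 val)/=.
have shiftE c : `|c| <= B -> (0 <= (c + B) / h) && ((c + B) / h < G.+1%:R).
  rewrite ler_norml => /andP[c1 c2]; apply/andP; split.
    by apply: divr_ge0 (ltW h0); rewrite -lerBlDr sub0r.
  apply: le_lt_trans BG; rewrite ler_pM2r ?invr_gt0//.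
  by rewrite mulr_natl mulr2n lerD2r.
have /andP[a0 aG] := shiftE a aB; have /andP[b0 bG] := shiftE b bB.
rewrite !inordK ?truncn_lt_nat// => ab.
have := truncn_itv a0; have := truncn_itv b0; rewrite ab.
move: (Num.trunc _) => m; rewrite !ler_pdivlMr// !ltr_pdivrMr//.
rewrite -natr1 mulrDl mul1r ler_norml.
move: (_ * h) => c {aB bB shiftE a0 b0 aG bG BG ab} /andP[? ?] /andP[? ?].
by apply/andP; split; lra.
Qed.

Lemma cell_close (G : nat) (B h : R) (x y : 'rV[R]_n) :
  0 < h -> 2 * B / h < G.+1%:R -> `|x| <= B -> `|y| <= B ->
  cell G B h x = cell G B h y -> `|x - y| <= h.
Proof.
move=> h0 BG xB yB /ffunP xy; apply: normr_row_le (ltW h0) _ => i.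
rewrite !mxE; apply: (inord_trunc_close h0 BG).
- exact: le_trans (normr_coord x i) xB.
- exact: le_trans (normr_coord y i) yB.
- by have := xy i; rewrite !ffunE.
Qed.

End Grid.

(** * Tiles, translations and overlaps *)

Section Tiles.
Context {R : realType} {d : nat} {A : prototiles R d}.
Implicit Types (P : set (tile A)) (s t : tile A) (x y : 'rV[R]_d).

Lemma tile_bounds : exists D r0 : R,
  [/\ 1 <= D, 0 < r0 <= 1,
      forall (p : A) y, proto_shape p y -> `|y| <= D &
      forall (p : A) y, `|y| < r0 -> proto_shape p y].
Proof.
have bnd (p : A) : exists M, forall y, proto_shape p y -> `|y| <= M.
  have /ex_strict_bound_gt0[M _ pM] := compact_bounded (@proto_compact _ _ A p).
  by exists M => y /pM/ltW.
have inn (p : A) : exists e, 0 < e /\ forall y, `|y| < e -> proto_shape p y.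
  have /interior_row[e e0 pe] := proto_origin p.
  by exists e; split => // y ye; apply: pe; rewrite subr0.
have [M bndM] := choice bnd; have [e inne] := choice inn.
exists (\big[Num.max/1]_p M p), (\big[Num.min/1]_p e p); split.
- exact: bigmax_ge_id.
- rewrite bigmin_le_id andbT; apply: lt_bigmin => // p _.
  by have [] := inne p.
- by move=> p y /bndM yM; apply: le_trans yM _; exact: le_bigmax.
- move=> p y ye; have [_] := inne p; apply; apply: lt_le_trans ye _.
  exact: bigmin_le.
Qed.

Lemma translateP x P t : translate x P t <-> P (t.1, t.2 - x).
Proof.
split=> [[s Ps <-]/=|Pt]; first by rewrite addrK -surjective_pairing.
by exists (t.1, t.2 - x) => //=; rewrite subrK -surjective_pairing.
Qed.

Lemma translateD x y P : translate x (translate y P) = translate (x + y) P.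
Proof.
apply/seteqP; split=> t; rewrite !translateP/= opprD addrA//.
Qed.

Lemma translate0 P : translate 0 P = P.
Proof.
by apply/seteqP; split=> t; rewrite translateP/= subr0 -surjective_pairing.
Qed.

Lemma tile_supportP t y : tile_support t y <-> proto_shape t.1 (y - t.2).
Proof.
split=> [[z pz <-]|py]; first by rewrite addrK.
by exists (y - t.2) => //; rewrite /puncture subrK.
Qed.

Lemma patch_support_translate x P y :
  patch_support (translate x P) y <-> patch_support P (y - x).
Proof.
split=> [[t /translateP Pt /tile_supportP ty]|[t Pt /tile_supportP ty]].
  by exists (t.1, t.2 - x) => //; apply/tile_supportP; rewrite /= opprB addrA subrK.
exists (t.1, t.2 + x); first by apply/translateP; rewrite /= addrK -surjective_pairing.
by apply/tile_supportP; rewrite /= [t.2 + x]addrC opprD addrA.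
Qed.

Definition overlap s t :=
  interior (tile_support s) `&` interior (tile_support t) !=set0.

(** The form in which disjointness of interiors is used: two tiles of a patch are identified by
    exhibiting an overlap. *)
Lemma is_patchP P :
  is_patch P <-> forall s t, P s -> P t -> overlap s t -> s = t.
Proof.
split=> [PP s t Ps Pt [y sty]|PP s t Ps Pt st]; last first.
  by apply/seteqP; split => // y sty; apply: st; apply: PP => //; exists y.
by apply: contrapT => st; move: sty; rewrite (PP s t Ps Pt st).
Qed.

Lemma interior_tile_support t y x :
  interior (tile_support t) y <-> interior (tile_support (t.1, t.2 + x)) (y + x).
Proof.
split=> /interior_row[e e0 ye]; apply/interior_row; exists e => // z zy.
  have /tile_supportP : tile_support t (z - x).
    by apply: ye; rewrite -addrA -opprD [x + y]addrC.
  by move=> tz; apply/tile_supportP; rewrite /= [t.2 + x]addrC opprD addrA.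
have /tile_supportP : tile_support (t.1, t.2 + x) (z + x).
  by apply: ye; rewrite opprD addrACA subrr addr0.
by move=> /= tz; apply/tile_supportP; move: tz; rewrite opprD addrACA subrr addr0.
Qed.

Lemma overlap_translate s t x :
  overlap s t <-> overlap (s.1, s.2 + x) (t.1, t.2 + x).
Proof.
split=> -[y [sy ty]].
  by exists (y + x); split; exact: (interior_tile_support _ _ x).1.
by exists (y - x); split; apply: (interior_tile_support _ _ x).2; rewrite subrK.
Qed.

Lemma is_patch_translate x P : is_patch P -> is_patch (translate x P).
Proof.
move=> /is_patchP PP; apply/is_patchP => s t /translateP Ps /translateP Pt.
move=> /(overlap_translate _ _ (- x)) /(PP _ _ Ps Pt)[s1 /addIr s2].
by rewrite [s]surjective_pairing s1 s2 -surjective_pairing.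
Qed.

End Tiles.

(** * Iterated substitution *)

Section Substitution.
Context {R : realType} {d : nat} {A : prototiles R d} (w : substitution A).
Implicit Types (P : set (tile A)) (s t : tile A) (x y : 'rV[R]_d).

Local Notation lam := (expansion w).
Local Notation om := (subst_patch w).

Lemma expansion_gt0 : 0 < lam.
Proof. exact: lt_trans (expansion_gt1 w). Qed.

Lemma expansionX_gt0 n : 0 < lam ^+ n.
Proof. by rewrite exprn_gt0// expansion_gt0. Qed.

Lemma expansionX_ge1 n : 1 <= lam ^+ n.
Proof. by rewrite exprn_ege1// ltW// expansion_gt1. Qed.

Lemma subst_patchP P t :
  om P t <-> exists2 s, P s & rule w s.1 (t.1, t.2 - lam *: s.2).
Proof. by split=> -[s Ps] => [/translateP|] st; exists s => //; apply/translateP. Qed.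

Lemma subst_patch_translate x P : om (translate x P) = translate (lam *: x) (om P).
Proof.
apply/seteqP; split=> t.
  move=> /subst_patchP[s /translateP Ps st]; apply/translateP/subst_patchP.
  by exists (s.1, s.2 - x) => //=; rewrite scalerBr opprB addrA subrK.
move=> /translateP/subst_patchP[s Ps st]; apply/subst_patchP.
exists (s.1, s.2 + x); first by apply/translateP; rewrite /= addrK -surjective_pairing.
by rewrite /= scalerDr [lam *: s.2 + _]addrC opprD addrA.
Qed.

Lemma iter_subst_translate n x P :
  iter n om (translate x P) = translate (lam ^+ n *: x) (iter n om P).
Proof.
elim: n => [|n IHn]; first by rewrite expr0 scale1r.
by rewrite !iterS IHn subst_patch_translate scalerA exprS.
Qed.

(** Iterates are unions over single tiles, so every tile of an iterate has a parent [s] whose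
    [n]-supertile contains it. *)
Lemma iter_substP n P t :
  iter n om P t <-> exists2 s, P s & iter n om [set s] t.
Proof.
elim: n t => [|n IHn] t.
  by split=> [Pt|[s Ps ->//]]; exists t.
rewrite iterS; split.
  move=> /subst_patchP[u /IHn[s Ps su] ut]; exists s => //.
  by apply/subst_patchP; exists u.
move=> [s Ps /subst_patchP[u su ut]]; apply/subst_patchP; exists u => //.
by apply/IHn; exists s.
Qed.

Lemma iter_subst_mono n P Q : P `<=` Q -> iter n om P `<=` iter n om Q.
Proof. by move=> PQ t /iter_substP[s /PQ Qs st]; apply/iter_substP; exists s. Qed.

Lemma iter_subst1 n s :
  iter n om [set s] = translate (lam ^+ n *: s.2) (subst_iter w n s.1).
Proof.
rewrite -iter_subst_translate; congr iter; apply/seteqP; split=> t.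
  by move=> ->; apply/translateP; rewrite /= subrr.
move=> /translateP[t1 /subr0_eq t2].
by rewrite [t]surjective_pairing t1 t2 -surjective_pairing.
Qed.

Lemma patch_support_subst P y :
  patch_support (om P) y <-> patch_support P (lam^-1 *: y).
Proof.
have l0 : lam != 0 by rewrite gt_eqF// expansion_gt0.
have ruleE p z : patch_support (rule w p) z <-> proto_shape p (lam^-1 *: z).
  rewrite rule_support; split=> [[u pu <-]|pz].
    by rewrite scalerA mulVf// scale1r.
  by exists (lam^-1 *: z) => //; rewrite scalerA mulfV// scale1r.
split.
  move=> [t /subst_patchP[s Ps st] /tile_supportP ty]; exists s => //.
  apply/tile_supportP.
  have /ruleE : patch_support (rule w s.1) (y - lam *: s.2).
    by exists (t.1, t.2 - lam *: s.2) => //; apply/tile_supportP;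
       rewrite /= opprB addrA subrK.
  by rewrite scalerBr scalerA mulVf// scale1r.
move=> [s Ps /tile_supportP sy].
have /ruleE[t st /tile_supportP ty] : proto_shape s.1 (lam^-1 *: (y - lam *: s.2)).
  by rewrite scalerBr scalerA mulVf// scale1r.
exists (t.1, t.2 + lam *: s.2).
  by apply/subst_patchP; exists s => //=; rewrite addrK -surjective_pairing.
by apply/tile_supportP; rewrite /= [t.2 + _]addrC opprD addrA.
Qed.

Lemma patch_support_iter n P y :
  patch_support (iter n om P) y <-> patch_support P (lam ^- n *: y).
Proof.
elim: n y => [|n IHn] y; first by rewrite expr0 invr1 scale1r.
by rewrite iterS patch_support_subst IHn scalerA exprSr invfM.
Qed.

Lemma patch_support1 s y : patch_support [set s] y <-> tile_support s y.
Proof. by split=> [[t ->]//|sy]; exists s. Qed.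

(** Dividing by [lam] sends the interior of a tile into the interior of its parent. Overlapping
    tiles thus have overlapping, hence equal, parents, and [rule_patch] concludes inside that
    parent. *)
Lemma is_patch_subst P : is_patch P -> is_patch (om P).
Proof.
move=> /is_patchP PP; apply/is_patchP => u v /subst_patchP[s Ps su].
move=> /subst_patchP[t Pt tv] uv.
have inner (a b : tile A) y : rule w a.1 (b.1, b.2 - lam *: a.2) ->
    interior (tile_support b) y -> interior (tile_support a) (lam^-1 *: y).
  move=> ab /interior_row[e e0 be]; apply/interior_row.
  exists (lam^-1 * e); first by rewrite mulr_gt0// invr_gt0 expansion_gt0.
  have l0 := expansion_gt0; have l1 : lam != 0 by rewrite gt_eqF.
  move=> z zy; have bz : tile_support b (lam *: z).
    apply: be; have -> : lam *: z - y = lam *: (z - lam^-1 *: y).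
      by rewrite scalerBr scalerA mulfV// scale1r.
    by rewrite normrZ gtr0_norm// mulrC -ltr_pdivlMr// mulrC.
  have : patch_support (om [set a]) (lam *: z).
    by exists b => //; apply/subst_patchP; exists a.
  by rewrite patch_support_subst patch_support1 scalerA mulVf// scale1r.
have st : s = t.
  apply: PP => //; case: uv => y [uy vy].
  by exists (lam^-1 *: y); split; [exact: inner uy | exact: inner vy].
move: tv; rewrite -st => sv; have /is_patchP rP := @rule_patch _ _ _ w s.1.
have /(rP _ _ su sv)[u1 /addIr u2] := (overlap_translate u v (- (lam *: s.2))).1 uv.
by rewrite [u]surjective_pairing u1 u2 -surjective_pairing.
Qed.

Lemma is_patch_iter n P : is_patch P -> is_patch (iter n om P).
Proof. by move=> PP; elim: n => // n; exact: is_patch_subst. Qed.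

Lemma is_patch1 s : is_patch [set s].
Proof. by move=> t u -> ->. Qed.

End Substitution.

(** * Finiteness by injection, and growth of powers *)

Lemma finite_set_inj (T : choiceType) (I : finType) (B : set T) (f : T -> I) :
  (forall x y, B x -> B y -> f x = f y -> x = y) -> finite_set B.
Proof.
move=> finj; have [[x0 Bx0]|B0] := pselect (B !=set0); last first.
  have -> : B = set0 by apply/seteqP; split=> // x Bx; case: B0; exists x.
  exact: finite_set0.
pose g c := xget x0 [set x | B x /\ f x = c].
apply: (sub_finite_set _ (finite_image g (@finite_finset I setT))) => x Bx.
exists (f x) => //; rewrite /g.
have [] := @xgetPex _ x0 [set y | B y /\ f y = f x] (ex_intro _ x (conj Bx erefl)).
by move=> ? ?; exact: finj.
Qed.

Lemma expr_unbounded (R : realType) (a b : R) : 1 < a -> exists k, b <= a ^+ k.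
Proof.
move=> a1; have a10 : 0 < a - 1 by rewrite subr_gt0.
have bern k : 1 + k%:R * (a - 1) <= a ^+ k.
  elim: k => [|k IHk]; first by rewrite mul0r addr0 expr0.
  rewrite exprS; apply: le_trans (_ : a * (1 + k%:R * (a - 1)) <= _); last first.
    by rewrite ler_pM2l// (lt_trans _ a1).
  rewrite -natr1; have : 0 <= k%:R * (a - 1) * (a - 1) by rewrite !mulr_ge0// ltW.
  by move: (k%:R) => m; lra.
exists (Num.bound `|b / (a - 1)|); apply: le_trans (bern _).
have := archi_boundP (normr_ge0 (b / (a - 1))); move: (Num.bound _) => k.
move=> /(le_lt_trans (ler_norm _)); rewrite ltr_pdivrMr// => /ltW bk.
by apply: le_trans bk _; rewrite lerDr.
Qed.

Lemma exists_expr_between (R : realType) (a r : R) :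
  1 < a -> 1 <= r -> exists k, r <= a ^+ k <= a * r.
Proof.
move=> a1 r1; have [k0 rk0] := expr_unbounded r a1.
have exk : exists k, r <= a ^+ k by exists k0.
(* The least exponent works by comparison with its predecessor; exponent 0 has none and relies on
   [1 <= r]. *)
case: (ex_minnP exk) => -[|k] rk kmin; [exists 0%N | exists k.+1].
  rewrite rk/= expr0; apply: (le_trans r1).
  by apply: ler_peMl; [exact: le_trans r1 | exact: ltW].
rewrite rk exprS ler_pM2l ?(lt_trans _ a1)//= ltW// ltNge.
by apply/negP => /kmin; rewrite ltnn.
Qed.

(** * Local geometry of tilings and supertiles *)

Section Repetitivity.
Context {R : realType} {d : nat} {A : prototiles R d} (w : substitution A).
Context (D r0 : R) (D1 : 1 <= D) (r0_bounds : 0 < r0 <= 1)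
  (shape_bounded : forall (p : A) y, proto_shape p y -> `|y| <= D)
  (shape_ball : forall (p : A) y, `|y| < r0 -> proto_shape p y).
Implicit Types (P S T : set (tile A)) (s t u : tile A) (x y : 'rV[R]_d).

Local Notation lam := (expansion w).
Local Notation om := (subst_patch w).

Let r0_gt0 : 0 < r0. Proof. by case/andP: r0_bounds. Qed.
Let D0 : 0 <= D. Proof. exact: le_trans D1. Qed.

Lemma tile_support_close t y : tile_support t y -> `|y - t.2| <= D.
Proof. by move=> /tile_supportP/shape_bounded. Qed.

Lemma interior_puncture t y : `|y - t.2| < r0 -> interior (tile_support t) y.
Proof.
move=> ty; apply/interior_row; exists (r0 - `|y - t.2|); first by rewrite subr_gt0.
move=> z zy; apply/tile_supportP/shape_ball.
have -> : z - t.2 = (z - y) + (y - t.2) by rewrite addrA subrK.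
by apply: le_lt_trans (ler_normD _ _) _; rewrite -ltrBrDr.
Qed.

Lemma support_puncture t : tile_support t t.2.
Proof. by apply/tile_supportP/shape_ball; rewrite subrr normr0. Qed.

(** The open ball of radius [r0] about a puncture is interior to its tile, so close punctures force
    an overlap. *)
Lemma punctures_separated P s t :
  is_patch P -> P s -> P t -> `|s.2 - t.2| < r0 -> s = t.
Proof.
move=> /is_patchP PP Ps Pt st; apply: PP => //; exists s.2.
by split; apply: interior_puncture; rewrite ?subrr ?normr0.
Qed.

(** Pigeonhole on a grid of mesh [r0 / 2]: tiles with the same prototile and the same cell coincide
    by [punctures_separated]. *)
Lemma finite_patch_ball P N :
  is_patch P -> finite_set [set t | P t /\ `|t.2| <= N].
Proof.
move=> PP; pose h := r0 / 2; have h0 : 0 < h by rewrite divr_gt0.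
pose G := Num.bound `|2 * N / h|.
pose f t := (t.1, cell G N h t.2).
apply: (@finite_set_inj _ _ _ f) => s t [Ps sN] [Pt tN] [_ st].
apply: (punctures_separated PP Ps Pt); apply: le_lt_trans (_ : h < r0).
  apply: (@cell_close _ _ G N h) => //.
  apply: le_lt_trans (ler_norm _) _.
  by apply: lt_trans (archi_boundP (normr_ge0 _)) _; rewrite ltr_nat.
by move: r0_gt0 => rp; rewrite /h; lra.
Qed.

Lemma tile_support_closed t : closed (tile_support t).
Proof.
have pcl : closed (proto_shape t.1).
  apply: compact_closed; first exact: norm_hausdorff.
  exact: (@proto_compact _ _ A t.1).
rewrite -[tile_support t]setCK; apply: open_closedC; rewrite openE => y /= ny.
have /interior_row[e e0 ye] : interior (~` proto_shape t.1) (y - t.2).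
  move: (closed_openC pcl); rewrite openE; apply => /= ty.
  by apply: ny; apply/tile_supportP.
apply/interior_row; exists e => // z zy /tile_supportP; apply: ye.
by rewrite opprB addrA subrK.
Qed.

(** Tiles are closed, so [finite_closed_cover] on the open ball about the puncture of [s] yields a
    tile of [F] with an interior point in that ball, hence interior to [s]. *)
Lemma tile_cover s F :
  finite_set F -> (forall y, `|y - s.2| < r0 -> patch_support F y) ->
  exists2 u, F u & overlap s u.
Proof.
move=> /finite_seqP[l ->] lF.
have [|||y|u ul [y [uy sy]]] := @finite_closed_cover _ _ l (@tile_support R d A)
    [set y | `|y - s.2| < r0].
- by move=> u _; exact: tile_support_closed.
- rewrite openE => y /= ys; apply/interior_row.
  exists (r0 - `|y - s.2|); first by rewrite subr_gt0.
  move=> z zy; have zE : z - s.2 = (z - y) + (y - s.2) by rewrite addrA subrK.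
  rewrite /= zE.
  by apply: le_lt_trans (ler_normD _ _) _; rewrite -ltrBrDr.
- by exists s.2; rewrite /= subrr normr0.
- by move=> /lF[u lu uy]; exists u.
- by exists u => //; exists y; split => //; exact: interior_puncture.
Qed.


(** Around [s] the tiling consists of tiles of [P]; one of them overlaps [s] and so equals it. The
    margin [2 * D] is a tile radius plus the radius [r0 <= D] of the ball to be covered. *)
Lemma tiling_fill T P N s :
  is_tiling T -> is_patch P -> (forall t, T t -> `|t.2| <= N -> P t) ->
  P s -> `|s.2| + 2 * D <= N -> T s.
Proof.
move=> [TT covT] PP TP Ps sN.
have [|y ys|u [Tu uN] su] := @tile_cover s [set t | T t /\ `|t.2| <= N].
- exact: finite_patch_ball.
- have [t Tt ty] : patch_support T y by rewrite covT.
  exists t => //; split=> //; have := tile_support_close ty.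
  rewrite distrC => ty'; have -> : t.2 = (t.2 - y) + ((y - s.2) + s.2).
    by rewrite subrK subrK.
  apply: le_trans (ler_normD _ _) _; apply: le_trans sN; rewrite addrC.
  have := ler_normD (y - s.2) s.2; case/andP: r0_bounds => _ r01.
  move: ys ty' D1; move: `|y - s.2| `|t.2 - y| `|_ + _| `|s.2| => a b c e; lra.
- by have /is_patchP/(_ _ _ Ps (TP _ Tu uN) su) -> := PP.
Qed.

Lemma supertile_support n s t : iter n om [set s] t ->
  forall y, tile_support t y -> tile_support s (lam ^- n *: y).
Proof.
move=> st y ty; apply/patch_support1; apply/patch_support_iter.
by exists t.
Qed.

Lemma supertile_close n s t y :
  iter n om [set s] t -> tile_support t y ->
  `|y - lam ^+ n *: s.2| <= D * lam ^+ n.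
Proof.
move=> st /(supertile_support st)/tile_support_close sy.
have ln0 := expansionX_gt0 w n.
have -> : y - lam ^+ n *: s.2 = lam ^+ n *: (lam ^- n *: y - s.2).
  by rewrite scalerBr scalerA mulfV ?scale1r// gt_eqF.
by rewrite normrZ gtr0_norm// mulrC ler_pM2r.
Qed.

Lemma supertile_near n s t :
  `|s.2| <= D -> iter n om [set s] t -> `|t.2| <= 2 * D * lam ^+ n.
Proof.
move=> sD st; have := supertile_close st (support_puncture t).
have : `|lam ^+ n *: s.2| <= D * lam ^+ n.
  by rewrite normrZ gtr0_norm ?expansionX_gt0// mulrC ler_pM2r ?expansionX_gt0.
move=> s2 ts; have -> : t.2 = (t.2 - lam ^+ n *: s.2) + lam ^+ n *: s.2.
  by rewrite subrK.
by apply: le_trans (ler_normD _ _) _; rewrite -mulrA mulr2n mulrDl mul1r lerD.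
Qed.

(** The tile of [T] over the origin has a parent in [P] whose support contains [lam ^- k *: 0 = 0].
    Its position is thus bounded independently of [k]. *)
Lemma origin_supertile T P N k :
  is_tiling T -> D <= N ->
  (forall t, T t -> `|t.2| <= N -> iter k om P t) ->
  exists2 s, P s & `|s.2| <= D.
Proof.
move=> [_ covT] DN TP.
have [t Tt t0] : patch_support T 0 by rewrite covT.
have := tile_support_close t0; rewrite sub0r normrN => tD.
have /iter_substP[s Ps st] := TP t Tt (le_trans tD DN).
exists s => //; have := supertile_support st t0.
by rewrite scaler0 => /tile_support_close; rewrite sub0r normrN.
Qed.

(** The support of [rule w q] contains 0, so this patch has a tile [t]; the induction hypothesis for
    the prototile of [t] then climbs one level. *)
Lemma primitive_large : primitive w ->
  exists n0, forall n, (n0 <= n)%N -> forall p q : A, exists x, subst_iter w n q (p, x).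
Proof.
move=> [n0 prim]; exists n0 => n /subnK <-; elim: (n - n0)%N => // m IHm p q.
have [t qt] : exists t, rule w q t.
  have [t qt _] : patch_support (rule w q) 0.
    rewrite rule_support; exists 0; last by rewrite scaler0.
    by apply: shape_ball; rewrite normr0.
  by exists t.
have [x px] := IHm p t.1; exists (x + lam ^+ (m + n0) *: t.2).
rewrite /subst_iter addSn iterSr; apply/iter_substP; exists t.
  apply/subst_patchP; exists (q, 0) => //=.
  by rewrite scaler0 subr0 -surjective_pairing.
by rewrite iter_subst1; apply/translateP; rewrite /= addrK.
Qed.

Definition is_supertile P := exists j p y, P = translate y (subst_iter w j p).

(** Legality refers to supertiles because desubstituting a piece of a tiling lands in a supertile;
    [legal_occurs] leads back to tilings. *)
Definition legal P := exists2 S, is_supertile S & P `<=` S.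

Lemma supertile_iter k S : is_supertile S -> is_supertile (iter k om S).
Proof.
move=> [j [p [y ->]]]; exists (k + j)%N, p, (lam ^+ k *: y).
by rewrite iter_subst_translate /subst_iter iterD.
Qed.

Lemma supertile_is_patch S : is_supertile S -> is_patch S.
Proof.
by move=> [j [p [y ->]]]; apply/is_patch_translate/is_patch_iter/is_patch1.
Qed.

Context (prim : primitive w).

(** A copy of [p] occurs in [subst_iter w (n0 + k) p]. After [j] more substitutions the given
    supertile sits in one of level [j + n0 + k], the [k]-th iterate of one of level [j + n0]. *)
Lemma supertile_raise k S : is_supertile S -> exists2 S', is_supertile S' & S `<=` iter k om S'.
Proof.
have [n0 n0P] := primitive_large prim.
move=> [j [p [y ->]]]; have [z pz] := n0P (n0 + k)%N (leq_addr _ _) p p.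
(* The shift from the copy, located at [lam ^+ j *: z], to the prescribed position [y]; it is
   divided by [lam ^+ k] before iterating. *)
pose x := y - lam ^+ j *: z.
have lk : lam ^+ k != 0 by rewrite gt_eqF// expansionX_gt0.
exists (translate (lam ^- k *: x) (subst_iter w (j + n0) p)).
  by exists (j + n0)%N, p, (lam ^- k *: x).
rewrite iter_subst_translate scalerA mulfV// scale1r.
have -> : iter k om (subst_iter w (j + n0) p) = iter j om (subst_iter w (n0 + k) p).
  by rewrite /subst_iter -!iterD addnC addnA.
move=> t /translateP tj; apply/translateP/iter_substP; exists (p, z) => //.
by rewrite iter_subst1; apply/translateP; rewrite /= /x opprB addrA addrAC addrK.
Qed.

(** The tiles near the origin form a finite patch, hence lie in a translated supertile, which
    [supertile_raise] places inside a [k]-th iterate. *)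
Lemma desubstitute T k N : tiling_space w T ->
  exists2 S, is_supertile S & forall t, T t -> `|t.2| <= N -> iter k om S t.
Proof.
move=> [[TT _] Tfin].
have [] := Tfin [set t | T t /\ `|t.2| <= N]; first by move=> t [].
  exact: finite_patch_ball.
move=> n [p [x TS]].
have [|S Ssup SP] := @supertile_raise k (translate (- x) (subst_iter w n p)).
  by exists n, p, (- x).
exists S => // t Tt tN; apply: SP; apply/translateP; rewrite opprK.
by apply: TS; apply/translateP; rewrite /= addrK -surjective_pairing.
Qed.


Definition spread (rho : R) P := forall s t, P s -> P t -> `|s.2 - t.2| <= rho.

Lemma spread_diam_le rho P : spread rho P -> diam_le P (d%:R * (rho + 2 * D)).
Proof.
move=> Prho y z [s Ps sy] [t Pt tz]; apply: le_trans (enorm_le_normr _) _.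
apply: ler_wpM2l => //; have := Prho s t Ps Pt.
have := tile_support_close sy; have := tile_support_close tz; rewrite distrC.
have -> : y - z = (y - s.2) + (s.2 - t.2) + (t.2 - z) by rewrite subrKA subrKA.
move=> b a c; apply: le_trans (ler_normD _ _) _.
rewrite mulr_natl mulr2n [rho + _]addrA; apply: (lerD _ b).
by apply: le_trans (ler_normD _ _) _; rewrite addrC; exact: lerD.
Qed.

(** * Legal patches: finitely many types, recurrence, repulsion and local codes *)

Section LegalPatches.
Context (flc : finite_local_complexity w) (T0 : set (tile A))
  (T0_tiling : tiling_space w T0).

(** By primitivity any supertile of level [j + n0] contains a copy of the supertile around [P], and
    [T0] contains such a supertile near the origin by [tiling_fill]. *)
Lemma legal_occurs P : legal P -> exists x, translate x P `<=` T0.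
Proof.
move=> [S1 [j [p [y ->]]] PS]; have [n0 n0P] := primitive_large prim.
(* The first summand bounds the punctures in the supertile near the origin ([supertile_near]), the
   second is the margin of [tiling_fill]. *)
pose k := (j + n0)%N; pose N := 2 * D * lam ^+ k + 2 * D.
have [TT _] := T0_tiling.
have [S Ssup TS] := desubstitute k N T0_tiling.
have [s Ss sD] : exists2 s, S s & `|s.2| <= D.
  apply: (@origin_supertile T0 S N k) => //; rewrite /N.
  have : 0 <= 2 * D * lam ^+ k by rewrite !mulr_ge0// ltW// expansionX_gt0.
  by move: D0; lra.
have [z pz] := n0P n0 (leqnn _) p s.1.
exists (lam ^+ k *: s.2 + lam ^+ j *: z - y) => t /translateP/PS/translateP/= tj.
have st : iter k om [set s] t.
  rewrite iter_subst1; apply/translateP.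
  rewrite /subst_iter /k iterD; apply/iter_substP; exists (p, z) => //.
  rewrite iter_subst1; apply/translateP => /=; move: tj; congr (iter _ _ _ (_, _)).
  by rewrite opprB addrA addrAC addrK opprD addrA.
apply: (@tiling_fill T0 (iter k om S) N) => //.
- exact/is_patch_iter/supertile_is_patch.
- by apply/iter_substP; exists s.
- by rewrite lerD2r; exact: supertile_near st.
Qed.

(** Each legal patch has a translate in [T0], where finite local complexity leaves finitely many
    candidates. *)
Lemma legal_types rho : 0 <= rho -> exists l : seq (set (tile A)),
  forall P, legal P -> spread rho P -> exists Q x, Q \in l /\ P = translate x Q.
Proof.
(* The added 1 keeps the radius positive even for [d = 0]. *)
move=> rho0; have r0' : 0 < d%:R * (rho + 2 * D) + 1.
  by rewrite ltr_wpDl// mulr_ge0// addr_ge0// mulr_ge0.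
have [F [/finite_seqP[l ->] Fl]] := flc r0'.
exists l => P Pleg /spread_diam_le Pd; have [x xP] := legal_occurs Pleg.
have [|Q [y [lQ PQ]]] := Fl T0 (translate x P) T0_tiling xP.
  move=> u v /patch_support_translate Pu /patch_support_translate Pv.
  have := Pd _ _ Pu Pv; rewrite opprD addrACA subrr addr0 => /le_trans; apply.
  by rewrite lerDl.
exists Q, (y - x); split => //.
have -> : P = translate (- x) (translate x P) by rewrite translateD addNr translate0.
by rewrite PQ translateD addrC.
Qed.

(** The code is the index of the translation type; [pos] is a reference puncture chosen once per
    type and carried along by translation, so differences of positions recover the translation. *)
Lemma legal_code rho : 0 <= rho ->
  exists (C : nat) (code : set (tile A) -> 'I_C.+1) (pos : set (tile A) -> 'rV[R]_d),
    (forall P, legal P -> spread rho P -> P !=set0 -> exists2 t, P t & pos P = t.2) /\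
    (forall P Q, legal P -> legal Q -> spread rho P -> spread rho Q ->
      code P = code Q -> Q = translate (pos Q - pos P) P).
Proof.
move=> /legal_types[l lP].
have exf P : exists fP : set (tile A) * 'rV[R]_d, legal P -> spread rho P ->
    fP.1 \in l /\ P = translate fP.2 fP.1.
  have [[Pleg Prho]|nP] := pselect (legal P /\ spread rho P).
    by have [Q [x PQ]] := lP P Pleg Prho; exists (Q, x).
  by exists (set0, 0) => ? ?; case: nP.
have exg P : exists y : 'rV[R]_d, P !=set0 -> exists2 t, P t & y = t.2.
  have [[t Pt]|nP] := pselect (P !=set0); first by exists t.2 => _; exists t.
  by exists 0.
have [f fP] := choice exf; have [g gP] := choice exg.
exists (size l), (fun P => inord (index (f P).1 l)), (fun P => (f P).2 + g (f P).1).
split.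
  move=> P Pleg Prho [t Pt]; have [_ PE] := fP P Pleg Prho.
  have [|u Qu ->] := gP (f P).1.
    by exists (t.1, t.2 - (f P).2); apply/translateP; rewrite -PE.
  exists (u.1, u.2 + (f P).2); last by rewrite addrC.
  suff : translate (f P).2 (f P).1 (u.1, u.2 + (f P).2) by rewrite -PE.
  by apply/translateP; rewrite /= addrK -surjective_pairing.
move=> P Q Pleg Qleg Prho Qrho /(congr1 val)/=.
have [Pl PE] := fP P Pleg Prho; have [Ql QE] := fP Q Qleg Qrho.
rewrite !inordK ?ltnS ?index_size// => /(congr1 (nth set0 l)).
rewrite !nth_index// => fPQ; rewrite -fPQ opprD addrACA subrr addr0.
have := translateD ((f Q).2 - (f P).2) (f P).2 (f P).1.
by rewrite -PE subrK fPQ -QE.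
Qed.

(** A type that occurs does so at all large enough levels ([primitive_large]), so the maximum over
    the finitely many types gives one [J]. Further substitutions turn this into recurrence at every
    scale. *)
Lemma legal_recurrent rho : 0 <= rho -> exists J, forall P, legal P -> spread rho P ->
  forall q : A, exists z, translate z P `<=` subst_iter w J q.
Proof.
move=> /legal_types[l lP]; have [n0 n0P] := primitive_large prim.
have occ P : exists n, legal P ->
    forall m, (n <= m)%N -> forall q : A, exists z, translate z P `<=` subst_iter w m q.
  have [[S [j [p [y ->]]] PS]|nP] := pselect (legal P); last by exists 0%N.
  exists (j + n0)%N => _ m jm q.
  have [|z pz] := n0P (m - j)%N _ p q.
    by rewrite leq_subRL// (leq_trans (leq_addr _ _) jm).
  exists (lam ^+ j *: z - y) => t /translateP/PS/translateP/= tj.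
  rewrite -(subnKC (leq_trans (leq_addr _ _) jm)) /subst_iter iterD.
  apply/iter_substP; exists (p, z) => //.
  rewrite iter_subst1; apply/translateP; move: tj; congr (iter _ _ _ (_, _)).
  by rewrite /= opprB addrA addrAC addrK.
have [n nP] := choice occ; exists (\max_(Q <- l) n Q) => P Pleg Prho q.
have [Q [x [Ql PE]]] := lP P Pleg Prho.
have Qleg : legal Q.
  move: Pleg => [S [j [p [y SE]]] PS]; exists (translate (- x) S).
    by exists j, p, (- x + y); rewrite SE translateD.
  move=> t Qt; apply/translateP; rewrite opprK; apply: PS; rewrite PE.
  by apply/translateP; rewrite /= addrK -surjective_pairing.
have [|z zQ] := nP Q Qleg (\max_(Q <- l) n Q) _ q.
  by apply: leq_bigmax_seq.
by exists (z - x); rewrite PE translateD subrK.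
Qed.


(* A tile of the k-supertile of [s], moved by at most lambda^k, stays within
   (2D + 1) lambda^k of the scaled puncture of [s]; the k-supertiles meeting it
   then have their punctures at most D further. *)
Definition star S s := [set s' | S s' /\ `|s'.2 - s.2| <= 3 * D + 1].

Lemma star_spread S s : spread (2 * (3 * D + 1)) (star S s).
Proof.
move=> a b [_ sa] [_]; rewrite distrC => sb.
have -> : a.2 - b.2 = (a.2 - s.2) + (s.2 - b.2) by rewrite addrA subrK.
apply: le_trans (ler_normD _ _) _.
by rewrite [leRHS]mulr_natl mulr2n; exact: lerD.
Qed.

Lemma star_legal S s : is_supertile S -> legal (star S s).
Proof. by exists S => // a []. Qed.

Lemma near_star S s k y u : S u ->
  `|y - lam ^+ k *: s.2| <= (2 * D + 1) * lam ^+ k ->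
  `|y - lam ^+ k *: u.2| <= D * lam ^+ k -> star S s u.
Proof.
move=> Su ys yu; split => //; have lk := expansionX_gt0 w k.
rewrite -(ler_pM2l lk) -[in leLHS](gtr0_norm lk) -normrZ.
have -> : lam ^+ k *: (u.2 - s.2) = (y - lam ^+ k *: s.2) - (y - lam ^+ k *: u.2).
  by rewrite scalerBr opprB [RHS]addrC subrKA.
apply: le_trans (ler_normB _ _) _; apply: le_trans (lerD ys yu) _.
by rewrite -mulrDl mulrC ler_pM2l//; lra.
Qed.

Lemma star_radius_ge0 : 0 <= 2 * (3 * D + 1).
Proof. by move: D0; lra. Qed.

(* A tile [t] and its star recur, shifted by some [v], within distance [r] of
   the origin; there [t + v + x] is a tile of the copied star, and pulling it
   back by [v] gives [t + x]. *)
Lemma repulsion_translate : exists c a : R, [/\ 0 < c, 1 <= a &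
  forall T r x, tiling_space w T -> a <= r -> `|x| <= c * r ->
    (forall t, T t -> `|t.2| <= r -> T (t.1, t.2 + x)) ->
    forall t, T t -> T (t.1, t.2 + x)].
Proof.
have [J JP] := legal_recurrent star_radius_ge0.
(* With [r / M <= lam ^+ k <= lam * (r / M)], the lower bound gives [|x| <= lam ^+ k], and the upper
   one puts the [(k + J)]-supertile near the origin within radius [r]. *)
pose M := 2 * D * lam ^+ J * lam.
have M1 : 1 <= M.
  have := expansionX_ge1 w J; have := expansion_gt1 w => l1 lJ.
  by rewrite /M !mulr_ege1// ?(ltW l1)//; move: D1; lra.
have M0 : 0 < M := lt_le_trans ltr01 M1.
exists M^-1, M; split => // [|T r x TO Mr xr Tx t Tt]; first by rewrite invr_gt0.
have [TT _] := TO; have [/is_patchP TP covT] := TT.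
have r0' : 0 <= r by apply: le_trans (ltW M0) Mr.
have [|k /andP[rk kr]] := @exists_expr_between R lam (r / M) (expansion_gt1 w).
  by rewrite ler_pdivlMr// mul1r.
have lk1 := expansionX_ge1 w k; have lk0 := expansionX_gt0 w k.
have xk : `|x| <= lam ^+ k by apply: le_trans xr _; rewrite mulrC.
have {}kr : 2 * D * lam ^+ (k + J) <= r.
  move: kr; rewrite mulrCA /M invfM [_^-1 * lam^-1]mulrC mulVKf; last first.
    by rewrite gt_eqF// expansion_gt0.
  rewrite ler_pdivlMr; last by rewrite !mulr_gt0 ?expansionX_gt0// (lt_le_trans ltr01).
  by rewrite exprD mulrC mulrA mulrAC.
(* Room for [t], for the tiles covering [t + x], and for the ball of radius [r] with the margin of
   [tiling_fill]. *)
pose N := `|t.2| + `|x| + r + 3 * D.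
have [S' S'sup TS'] := desubstitute (k + J) N TO.
(* One desubstitution serves two scales: [S] provides the [k]-supertiles around [t], and [S'] the
   [(k + J)]-supertile near the origin in which their star recurs. *)
pose S := iter J om S'; have Ssup : is_supertile S := supertile_iter J S'sup.
have TS u : T u -> `|u.2| <= N -> iter k om S u.
  by move=> Tu uN; rewrite /S -iterD; exact: TS'.
have [|s' S's' s'D] := @origin_supertile T S' N (k + J) TT _ TS'.
  rewrite /N; have := normr_ge0 t.2; have := normr_ge0 x; move: r0' D0.
  by move: `|t.2| `|x| => a b; lra.
have /iter_substP[s Ss st] : iter k om S t.
  apply: TS => //; rewrite /N; have := normr_ge0 x; move: r0' D0.
  by move: `|t.2| `|x| => a b; lra.
have [z zP] := JP _ (star_legal s Ssup) (@star_spread S s) s'.1.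
pose v := lam ^+ k *: (lam ^+ J *: s'.2 + z).
have copy u : iter k om (star S s) u -> T (u.1, u.2 + v) /\ `|u.2 + v| <= r.
  move=> su; have s'u : iter (k + J) om [set s'] (u.1, u.2 + v).
    rewrite iterD iter_subst1.
    have : translate v (iter k om (star S s)) (u.1, u.2 + v).
      by apply/translateP; rewrite /= addrK -surjective_pairing.
    rewrite /v -iter_subst_translate -translateD; apply: iter_subst_mono.
    by move=> a /translateP az; apply/translateP; exact: zP.
  have ur := le_trans (supertile_near s'D s'u) kr; split => //.
  apply: (@tiling_fill T (iter (k + J) om S') N) => //.
  - exact/is_patch_iter/supertile_is_patch.
  - by apply/iter_substP; exists s'.
  - move: ur => /=; rewrite /N; have := normr_ge0 t.2; have := normr_ge0 x.
    by move: D0; move: `|t.2| `|x| `|_ + _| => a b c; lra.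
(* Some tile [u] of [T] overlaps [t + x]; it remains to see that [u] is [t + x]. *)
have [|y yt|u [Tu uN] tu] :=
    @tile_cover (t.1, t.2 + x) [set u | T u /\ `|u.2| <= N].
- by apply: finite_patch_ball; case: TT.
- have [u Tu uy] : patch_support T y by rewrite covT.
  exists u => //; split=> //; have := tile_support_close uy; rewrite distrC.
  move: yt => /= yt uy'.
  have -> : u.2 = (u.2 - y) + ((y - (t.2 + x)) + (t.2 + x)) by rewrite !subrK.
  apply: le_trans (ler_normD _ _) _; apply: le_trans (lerD uy' (ler_normD _ _)) _.
  apply: le_trans (lerD (lexx _) (lerD (ltW yt) (ler_normD _ _))) _.
  case/andP: r0_bounds => _ r01; rewrite /N; move: r0' D1.
  by move: `|t.2| `|x| => a b; lra.
have [y [/interior_subset ty /interior_subset uy]] := tu.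
have /iter_substP[s2 Ss2 s2u] := TS u Tu uN.
have su : iter k om (star S s) u.
  apply/iter_substP; exists s2 => //.
  apply: (@near_star S s k y) => //; last exact: supertile_close uy.
  have -> : y - lam ^+ k *: s.2 =
      (y - (t.2 + x)) + ((t.2 - lam ^+ k *: s.2) + x).
    by rewrite [t.2 - _ + x]addrAC addrA subrK.
  apply: le_trans (ler_normD _ _) _.
  have /= ty' := tile_support_close ty.
  have st' := supertile_close st (support_puncture t).
  apply: le_trans (lerD ty' (ler_normD _ _)) _.
  apply: le_trans (lerD (lexx _) (lerD st' xk)) _.
  have : D <= D * lam ^+ k by rewrite ler_peMr.
  by move: (lam ^+ k) => l; nra.
have ts : iter k om (star S s) t.
  apply/iter_substP; exists s => //; split => //.
  by rewrite subrr normr0; move: D0; lra.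
have [Ttv tvr] := copy t ts; have [Tuv _] := copy u su.
have := Tx _ Ttv tvr; rewrite /= => Ttvx.
have : (t.1, t.2 + v + x) = (u.1, u.2 + v).
  apply: TP => //; rewrite addrAC.
  exact: (overlap_translate (t.1, t.2 + x) u v).1.
by rewrite addrAC => -[-> /addIr ->]; rewrite -surjective_pairing.
Qed.

(** [repulsion_translate] gives only that [T + x] is contained in [T]. For the converse, a tile [u]
    of [T] overlapping [t - x] has [u + x] in [T] overlapping [t], hence equal to it; so [x] is a
    period. *)
Lemma repulsion : aperiodic w -> exists c a : R, [/\ 0 < c, 1 <= a &
  forall T r x, tiling_space w T -> a <= r -> `|x| <= c * r ->
    (forall t, T t -> `|t.2| <= r -> T (t.1, t.2 + x)) -> x = 0].
Proof.
move=> aper; have [c [a [c0 a1 rep]]] := repulsion_translate.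
exists c, a; split => // T r x TO ar xr Tx; apply: contrapT => x0.
have {}Tx := rep T r x TO ar xr Tx.
apply: aper; exists T, x; split => //; apply/seteqP; split => t.
  by move=> /translateP /Tx; rewrite /= subrK -surjective_pairing.
move=> Tt; have [TT _] := TO; have [/is_patchP TP covT] := TT.
pose N := `|t.2 - x| + 1 + D.
have [|y yt|u [Tu _] tu] :=
    @tile_cover (t.1, t.2 - x) [set u | T u /\ `|u.2| <= N].
- by apply: finite_patch_ball; case: TT.
- have [u Tu uy] : patch_support T y by rewrite covT.
  exists u => //; split=> //; have := tile_support_close uy; rewrite distrC.
  move: yt => /= yt uy'.
  have -> : u.2 = (u.2 - y) + ((y - (t.2 - x)) + (t.2 - x)) by rewrite !subrK.
  apply: le_trans (ler_normD _ _) _; apply: le_trans (lerD uy' (ler_normD _ _)) _.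
  apply: le_trans (lerD (lexx _) (lerD (ltW yt) (lexx _))) _.
  case/andP: r0_bounds => _ r01; rewrite /N.
  by move: `|_ - _| => b; lra.
exists u => //; apply: TP => //; first exact: Tx.
have := (overlap_translate (t.1, t.2 - x) u x).1 tu.
rewrite /= subrK -surjective_pairing => -[y [ty uy]]; by exists y.
Qed.


(** The ball of radius [r] is described by a star of [k]-supertiles with [lam ^+ k] comparable to
    [r]. The code records the type of the star and the grid cell of its reference puncture. *)
Lemma local_code : exists (C : nat) (B : R), 0 < B /\
  forall r h G, 1 <= r -> 0 < h -> B * r / h < G.+1%:R ->
  exists code : set (tile A) -> 'I_C.+1 * {ffun 'I_d -> 'I_G.+1},
    forall T1 T2, tiling_space w T1 -> tiling_space w T2 -> code T1 = code T2 ->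
    exists x, [/\ `|x| <= h,
      forall t, T1 t -> `|t.2| <= r -> T2 (t.1, t.2 + x) &
      forall t, T2 t -> `|t.2| <= r -> T1 (t.1, t.2 - x)].
Proof.
have [C [lcode [pos [posP lcodeP]]]] := legal_code star_radius_ge0.
(* Bounds the punctures of the star: [3 * D + 1] from its centre, itself within [D] of the
   origin. *)
pose B := 4 * D + 1; have B0 : 0 < B by move: D0; rewrite /B; lra.
have l0 := expansion_gt0 w.
exists C, (2 * B * lam); split=> [|r h G r1 h0 BG]; first by rewrite !mulr_gt0.
have [k /andP[rk kr]] := exists_expr_between (expansion_gt1 w) r1.
have lk0 := expansionX_gt0 w k.
have rgt0 : 0 < r := lt_le_trans ltr01 r1.
(* The mesh before inflation: multiplied by [lam ^+ k <= lam * r] it is at most [h]. *)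
pose h' := h / (lam * r); have h'0 : 0 < h' by rewrite divr_gt0// mulr_gt0.
pose N := r + h + 2 * D.
(* The inflated star contains the tiles of [T] up to radius [r], and [T] contains its tiles up to
   [r + h], so tiles shifted by at most [h] can still be transferred. *)
have starT T : exists P, tiling_space w T -> [/\ legal P, spread (2 * (3 * D + 1)) P,
    P !=set0, (forall s, P s -> `|s.2| <= B) &
    (forall t, T t -> `|t.2| <= r -> iter k om P t) /\
    (forall t, iter k om P t -> `|t.2| <= r + h -> T t)].
  have [TO|nTO] := pselect (tiling_space w T); last by exists set0.
  have [S Ssup TS] := desubstitute k N TO; have [TT _] := TO.
  have [|s Ss sD] := @origin_supertile T S N k TT _ TS.
    by move: h0 r1 D0; rewrite /N; lra.
  exists (star S s) => _; split; [exact: star_legal | exact: star_spread | | |].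
  - by exists s; split => //; rewrite subrr normr0; move: D0; lra.
  - move=> u [_ us]; have -> : u.2 = (u.2 - s.2) + s.2 by rewrite subrK.
    apply: le_trans (ler_normD _ _) _; apply: le_trans (lerD us sD) _.
    by rewrite /B; lra.
  - split=> t Tt tr.
      have /iter_substP[u Su ut] : iter k om S t.
        by apply: TS => //; move: h0 D0; rewrite /N; lra.
      apply/iter_substP; exists u => //.
      apply: (@near_star S s k t.2 u Su); last first.
        exact: supertile_close ut (support_puncture t).
      apply: le_trans (ler_normB _ _) _; rewrite normrZ gtr0_norm//.
      have : lam ^+ k * `|s.2| <= lam ^+ k * D by rewrite ler_pM2l.
      move: (mulr_ge0 D0 (ltW lk0)) tr rk.
      by move: (lam ^+ k) `|t.2| `|s.2| => l a b; lra.
    apply: (@tiling_fill T (iter k om S) N) => //.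
    + exact/is_patch_iter/supertile_is_patch.
    + by move: Tt; apply: iter_subst_mono => u [].
    + by rewrite lerD2r.
have [st stP] := choice starT.
exists (fun T => (lcode (st T), cell G B h' (pos (st T)))).
have posB T : tiling_space w T -> `|pos (st T)| <= B.
  move=> /stP[leg spr ne sB _]; have [s Ps ->] := posP _ leg spr ne.
  exact: sB.
have transfer T1 T2 x : tiling_space w T1 -> tiling_space w T2 ->
    st T2 = translate x (st T1) -> `|lam ^+ k *: x| <= h ->
    forall t, T1 t -> `|t.2| <= r -> T2 (t.1, t.2 + lam ^+ k *: x).
  move=> /stP[_ _ _ _ [T1st _]] /stP[_ _ _ _ [_ stT2]] stE xh t Tt tr.
  apply: stT2; last by apply: le_trans (ler_normD _ _) _; exact: lerD.
  rewrite stE iter_subst_translate; apply/translateP.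
  by rewrite /= addrK -surjective_pairing; exact: T1st.
move=> T1 T2 T1O T2O [cE cellE].
have [leg1 spr1 _ _ _] := stP _ T1O; have [leg2 spr2 _ _ _] := stP _ T2O.
pose x := pos (st T2) - pos (st T1).
have xh' : `|x| <= h'.
  apply: (@cell_close _ _ G B h') => //; try exact: posB.
  by rewrite /h' invf_div !mulrA.
have xh : `|lam ^+ k *: x| <= h.
  rewrite normrZ gtr0_norm//.
  apply: le_trans (ler_pM (ltW lk0) (normr_ge0 _) kr xh') _.
  by rewrite /h' mulrC divfK// gt_eqF// mulr_gt0.
exists (lam ^+ k *: x); split => //.
  by apply: transfer => //; exact: lcodeP.
move=> t T2t tr; rewrite -scalerN; apply: (transfer T2 T1) => //.
  by rewrite opprB; exact: lcodeP.
by rewrite scalerN normrN.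
Qed.

End LegalPatches.

End Repetitivity.

(** * Sparse digit expansions *)

Section DigitExpansion.
Context {R : realType} (K : nat) (K0 : (0 < K)%N).

(* With digits below K in base 4K, everything after the first differing digit
   contributes at most half of that digit's weight. *)
Definition digit_ratio : R := (4 * K)%:R^-1.
Local Notation q := digit_ratio.

Definition digit_sum (a : nat -> nat) (N : nat) : R :=
  \sum_(0 <= m < N) (a m)%:R * q ^+ m.

Definition digit_value (a : nat -> nat) : R := limn (digit_sum a).

Lemma digit_ratio_gt0 : 0 < q.
Proof. by rewrite invr_gt0 ltr0n muln_gt0. Qed.

Lemma digit_ratioK : 4 * K%:R * q = 1.
Proof. by rewrite /digit_ratio natrM mulfV// mulf_neq0// pnatr_eq0 -lt0n. Qed.

Lemma digit_ratio_le : q <= 4^-1.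
Proof.
by rewrite lef_pV2 ?posrE ?ltr0n ?muln_gt0// ler_nat leq_pmulr.
Qed.

Lemma digit_sum_cvg a : (forall m, (a m < K)%N) -> digit_sum a @ \oo --> digit_value a.
Proof.
move=> aK; have q0 := digit_ratio_gt0.
apply: (@series_le_cvg R (fun m => (a m)%:R * q ^+ m) (geometric K%:R q)).
- by move=> m; rewrite mulr_ge0// exprn_ge0// ltW.
- by move=> m; rewrite /= mulr_ge0// exprn_ge0// ltW.
- move=> m /=; rewrite ler_pM2r ?exprn_gt0// ler_nat ltnW//.
- apply: is_cvg_geometric_series; rewrite gtr0_norm//.
  by apply: le_lt_trans digit_ratio_le _; rewrite invf_lt1// ltr1n.
Qed.

(** The bound telescopes: a new term is at most [K%:R * q ^+ N], and this is at most
    [2 * K%:R * (q ^+ N - q ^+ N.+1)]. *)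
Lemma digit_tail a b n N : (forall m, (a m < K)%N) -> (forall m, (b m < K)%N) ->
  (n <= N)%N ->
  `|(digit_sum a N - digit_sum b N) - (digit_sum a n - digit_sum b n)|
    <= 2 * K%:R * (q ^+ n - q ^+ N).
Proof.
move=> aK bK; elim: N => [|N IHN].
  by rewrite leqn0 => /eqP ->; rewrite !subrr normr0 mulr0.
rewrite leq_eqVlt => /predU1P[->|]; first by rewrite !subrr normr0 mulr0.
rewrite ltnS => /IHN {}IHN; have q0 := digit_ratio_gt0.
have abK : `|(a N)%:R - (b N)%:R| <= K%:R :> R.
  have : (a N)%:R <= K%:R :> R by rewrite ler_nat ltnW.
  have : (b N)%:R <= K%:R :> R by rewrite ler_nat ltnW.
  have := ler0n R (a N); have := ler0n R (b N); rewrite ler_norml.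
  by move: (a N)%:R (b N)%:R K%:R => x y z; lra.
have abN : `|((a N)%:R - (b N)%:R) * q ^+ N| <= K%:R * q ^+ N.
  by rewrite normrM [`|q ^+ N|]gtr0_norm ?exprn_gt0// ler_wpM2r// exprn_ge0// ltW.
rewrite /digit_sum !big_nat_recr//= -!/(digit_sum _ _).
have -> : digit_sum a N + (a N)%:R * q ^+ N - (digit_sum b N + (b N)%:R * q ^+ N)
   - (digit_sum a n - digit_sum b n) =
   ((digit_sum a N - digit_sum b N) - (digit_sum a n - digit_sum b n)) +
   ((a N)%:R - (b N)%:R) * q ^+ N by ring.
apply: le_trans (ler_normD _ _) _; apply: le_trans (lerD IHN abN) _.
have qN0 : 0 < q ^+ N by rewrite exprn_gt0.
rewrite exprS.
have : K%:R * (q * q ^+ N) * 4 = q ^+ N.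
  by rewrite mulrA mulrAC -[_ * 4]mulrC [4 * _]mulrA digit_ratioK mul1r.
have : 1 <= K%:R :> R by rewrite ler1n.
move: (q ^+ N) (K%:R) (q * _) qN0 => y k z; nra.
Qed.

Lemma digit_value_tail a b n : (forall m, (a m < K)%N) -> (forall m, (b m < K)%N) ->
  `|(digit_value a - digit_value b) - (digit_sum a n - digit_sum b n)|
    <= 2 * K%:R * q ^+ n.
Proof.
move=> aK bK; have ca := digit_sum_cvg aK; have cb := digit_sum_cvg bK.
pose c := digit_sum a n - digit_sum b n.
have cab : (fun N => `|(digit_sum a N - digit_sum b N) - c|) @ \oo -->
    `|(digit_value a - digit_value b) - c|.
  by apply: cvg_norm; apply: cvgB; [exact: cvgB | exact: cvg_cst].
rewrite -(cvg_lim (@Rhausdorff R) cab); apply: limr_le.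
  by apply/cvg_ex; eexists; exact: cab.
exists n => // N /= nN; apply: le_trans (digit_tail aK bK nN) _.
by rewrite ler_wpM2l// lerBlDr lerDl exprn_ge0// ltW// digit_ratio_gt0.
Qed.

Lemma digit_sum_eq a b n : (forall m, (m < n)%N -> a m = b m) ->
  digit_sum a n = digit_sum b n.
Proof. by move=> ab; apply: eq_big_nat => m /andP[_ /ab ->]. Qed.

Lemma digit_value_le a b n : (forall m, (a m < K)%N) -> (forall m, (b m < K)%N) ->
  (forall m, (m < n)%N -> a m = b m) ->
  `|digit_value a - digit_value b| <= 2 * K%:R * q ^+ n.
Proof.
move=> aK bK ab; have := digit_value_tail n aK bK.
by rewrite (digit_sum_eq ab) subrr subr0.
Qed.

(** Distinct integer digits differ by at least 1, and the tail cancels at most half of the resulting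
    [q ^+ n]. *)
Lemma digit_value_ge a b n : (forall m, (a m < K)%N) -> (forall m, (b m < K)%N) ->
  (forall m, (m < n)%N -> a m = b m) -> a n <> b n ->
  q ^+ n / 2 <= `|digit_value a - digit_value b|.
Proof.
move=> aK bK ab nab; have := digit_value_tail n.+1 aK bK.
have -> : digit_sum a n.+1 - digit_sum b n.+1 = ((a n)%:R - (b n)%:R) * q ^+ n.
  rewrite /digit_sum !big_nat_recr//= -!/(digit_sum _ _) (digit_sum_eq ab).
  by rewrite mulrBl opprD addrACA subrr add0r.
have qn0 : 0 < q ^+ n by rewrite exprn_gt0// digit_ratio_gt0.
have : q ^+ n <= `|((a n)%:R - (b n)%:R) * q ^+ n|.
  rewrite normrM [`|q ^+ n|]gtr0_norm// ler_peMl ?(ltW qn0)//.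
  have : (a n != b n) by apply/eqP.
  rewrite neq_ltn => /orP[] lt.
    rewrite distrC ger0_norm ?subr_ge0 ?ler_nat 1?ltnW//.
    by rewrite lerBrDr nat1r ler_nat.
  rewrite ger0_norm ?subr_ge0 ?ler_nat 1?ltnW//.
  by rewrite lerBrDr nat1r ler_nat.
have -> : 2 * K%:R * q ^+ n.+1 = q ^+ n / 2.
  have -> : 2 * K%:R * q ^+ n.+1 = 4 * K%:R * q * (q ^+ n / 2) by rewrite exprS; field.
  by rewrite digit_ratioK mul1r.
move: (q ^+ n) (((a n)%:R - (b n)%:R) * _) (digit_value a - digit_value b).
move=> y c v yc vc.
have := ler_normB v (v - c); rewrite subKr => cv.
by move: yc vc cv; move: `|c| `|v - c| `|v| => e f g; lra.
Qed.

End DigitExpansion.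

(** * Embedding a sequence of nested partitions *)

Lemma card_le_injective (I J : finType) :
  (#|I| <= #|J|)%N -> exists f : I -> J, injective f.
Proof.
move=> IJ; exists (fun i => enum_val (widen_ord IJ (enum_rank i))) => i j.
by move=> /enum_val_inj/(congr1 val)/= /val_inj/enum_rank_inj.
Qed.

(** An injection of [I] into [n]-tuples of digits below [K] turns codes into [n] expansions. Two
    points first separated at level [m.+1] have their first differing digit, in some coordinate, at
    index [m]. *)
Lemma nested_equivalence_embedding (R : realType) (U : choiceType) (X : set U)
    (E : nat -> U -> U -> Prop) (I : finType) (n K : nat) (code : nat -> U -> I) :
  (0 < K)%N -> (#|I| <= K ^ n)%N ->
  (forall m x, E m x x) -> (forall m x y, E m x y -> E m y x) ->
  (forall m x y z, E m x y -> E m y z -> E m x z) ->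
  (forall m x y, E m.+1 x y -> E m x y) ->
  (forall m x y, X x -> X y -> E m x y -> code m x = code m y -> E m.+1 x y) ->
  exists F : U -> 'rV[R]_n, forall m x y, X x -> X y -> E m x y -> ~ E m.+1 x y ->
    digit_ratio K ^+ m / 2 <= enorm (F x - F y) <=
      n%:R * (2 * K%:R * digit_ratio K ^+ m).
Proof.
move=> K0 IK Erefl Esym Etrans Emono Ecode.
have [[x0 _]|X0] := pselect (X !=set0); last first.
  by exists (fun=> 0) => m x y Xx; case: X0; exists x.
have [f finj] : exists f : I -> {ffun 'I_n -> 'I_K}, injective f.
  by apply: card_le_injective; rewrite card_ffun !card_ord.
(* A representative depending only on the class, since [code m] need not be constant on the classes
   of [E m.+1]. *)
pose rep m x := xget x0 [set y | X y /\ E m x y].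
have repP m x : X x -> X (rep m x) /\ E m x (rep m x).
  by move=> Xx; apply: (@xgetPex _ x0 [set y | X y /\ E m x y]); exists x.
have repE m x y : E m x y -> rep m x = rep m y.
  move=> xy; congr xget; apply/seteqP; split=> z [Xz zE]; split => //.
    exact: Etrans (Esym _ _ _ xy) zE.
  exact: Etrans xy zE.
pose digit x i m : nat := f (code m (rep m.+1 x)) i.
have digitK x i m : (digit x i m < K)%N by exact: ltn_ord.
exists (fun x => \row_i digit_value K (digit x i)) => m x y Xx Xy xy nxy.
have Ele k : (k <= m)%N -> E k x y.
  move=> km; move: xy; rewrite -(subnK km).
  by elim: (m - k)%N => // j IHj /Emono/IHj.
have eqd i k : (k < m)%N -> digit x i k = digit y i k.
  by move=> km; rewrite /digit (repE _ _ _ (Ele k.+1 km)).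
(* Otherwise the two representatives of level [m.+1], already related by [E m], would have equal
   codes and be related by [E m.+1]. *)
have [i nd] : exists i, digit x i m <> digit y i m.
  apply: contrapT => /forallNP alleq; apply: nxy.
  have [Xrx xr] := repP m.+1 x Xx; have [Xry yr] := repP m.+1 y Xy.
  have codeE : code m (rep m.+1 x) = code m (rep m.+1 y).
    by apply: finj; apply/ffunP => i; apply: val_inj; exact: contrapT (alleq i).
  have rxy : E m (rep m.+1 x) (rep m.+1 y).
    apply: (Etrans _ _ _ _ _ (Emono _ _ _ yr)).
    exact: (Etrans _ _ _ _ (Esym _ _ _ (Emono _ _ _ xr)) xy).
  apply: (Etrans _ _ _ _ xr); apply: (Etrans _ _ _ _ _ (Esym _ _ _ yr)).
  exact: Ecode.
apply/andP; split.
  apply: le_trans (enorm_coord _ i); rewrite !mxE.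
  by apply: digit_value_ge => // k km; exact: eqd.
apply: enorm_le_coord => [|j].
  by rewrite !mulr_ge0// exprn_ge0// ltW// digit_ratio_gt0.
by rewrite !mxE; apply: digit_value_le => // k km; exact: eqd.
Qed.

(** * Agreement on balls and the ultrametric *)

Section Agreement.
Context {R : realType} {d : nat} {A : prototiles R d}.
Implicit Types (T : set (tile A)) (t : tile A).

Lemma agree_on_ball_mono T T' (r r' : R) :
  r' <= r -> agree_on_ball T T' r -> agree_on_ball T T' r'.
Proof.
move=> r'r TT'.
have half T1 T2 : agree_on_ball T1 T2 r -> forall t,
    T1 t -> tile_support t `&` eball r' !=set0 -> T2 t.
  move=> T12 t T1t [y [ty yr']].
  suff [] : [set t | T2 t /\ tile_support t `&` eball r !=set0] t by [].
  by rewrite -T12; split => //; exists y; split => //; exact: le_trans r'r.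
apply/seteqP; split=> t [Tt tr]; split => //.
  exact: half TT' _ Tt tr.
exact: half (esym TT') _ Tt tr.
Qed.

(** By monotonicity one radius of disagreement bounds all radii of agreement, so their supremum lies
    above each of them. *)
Lemma rho_bounds T T' (r : R) : T <> T' -> 0 <= r -> ~ agree_on_ball T T' r ->
  1 / (1 + r) <= rho T T' <= 1 /\
  forall r', 0 <= r' -> agree_on_ball T T' r' -> rho T T' <= 1 / (1 + r').
Proof.
move=> TT' r0 nr; rewrite /rho; case: asboolP => // _.
set Z := [set s | _]; have Zr : ubound Z r.
  move=> s [s0 sT]; rewrite leNgt; apply/negP => /ltW rs.
  exact: nr (agree_on_ball_mono rs sT).
have Zsup s : Z s -> s <= sup Z by apply: ub_le_sup; exists r.
have sup0r : 0 <= sup Z <= r.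
  have [[s Zs]|Z0] := pselect (Z !=set0).
    by rewrite (le_trans _ (Zsup s Zs)) ?(proj1 Zs)//= ge_sup//; exists s.
  have -> : Z = set0 by apply/seteqP; split=> // s Zs; case: Z0; exists s.
  by rewrite sup0 lexx.
have inv_le (a b : R) : 0 <= a -> a <= b -> 1 / (1 + b) <= 1 / (1 + a).
  move=> a0 ab; have b0 := le_trans a0 ab.
  by rewrite !div1r lef_pV2 ?posrE ?ltr_pwDl// lerD2l.
case/andP: sup0r => s0 sr; split.
  rewrite inv_le//=; have := inv_le 0 (sup Z) (lexx _) s0.
  by rewrite addr0 divr1.
by move=> r' r'0 TTr'; apply: inv_le => //; exact: Zsup.
Qed.

End Agreement.

Section AgreementTiles.
Context {R : realType} {d : nat} {A : prototiles R d}.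
Context (D r0 : R) (r0_gt0 : 0 < r0)
  (shape_bounded : forall (p : A) y, proto_shape p y -> `|y| <= D)
  (shape_ball : forall (p : A) y, `|y| < r0 -> proto_shape p y).
Implicit Types (T : set (tile A)) (t : tile A).

(** A tile contains its puncture; the factor [d%:R] passes from the sup norm to the Euclidean
    one. *)
Lemma agree_on_ball_mem T T' (r : R) t :
  agree_on_ball T T' r -> T t -> d%:R * `|t.2| <= r -> T' t.
Proof.
move=> TT' Tt tr; suff [] : [set t | T' t /\ tile_support t `&` eball r !=set0] t by [].
rewrite -TT'; split => //; exists t.2; split.
  by apply/tile_supportP/shape_ball; rewrite subrr normr0.
exact: le_trans (enorm_le_normr _) tr.
Qed.

(** A tile meeting the ball of radius [r] has its puncture within [r + D]. *)
Lemma mem_agree_on_ball T T' (r : R) :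
  (forall t, `|t.2| <= r + D -> T t <-> T' t) -> agree_on_ball T T' r.
Proof.
move=> TT'; apply/seteqP; split=> t [Tt [y [ty yr]]]; (split; last by exists y);
  apply/TT' => //.
all: have /tile_supportP/shape_bounded := ty; rewrite distrC => tyD.
all: rewrite -[t.2](subrK y) (le_trans (ler_normD _ _))// addrC lerD//.
all: exact: le_trans (normr_le_enorm _) yr.
Qed.

End AgreementTiles.

(** * Choice of constants and bi-Lipschitz bounds on the transversal *)

Theorem theorem3p4 (R : realType) (d : nat) (A : prototiles R d)
    (w : substitution A) :
  (0 < d)%N -> primitive w -> aperiodic w -> finite_local_complexity w ->
  exists (F : set (tile A) -> 'rV[R]_(d.+1)) (cm cp : R),
    [/\ 0 < cm, cm <= cp &
        forall T T' : set (tile A),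
          canonical_transversal w T -> canonical_transversal w T' ->
          cm * rho T T' <= enorm (F T - F T') <= cp * rho T T'].
Proof.
move=> d0 prim aper flc.
have [[T0 [T0O _]]|noT] := pselect (canonical_transversal w !=set0); last first.
  by exists (fun=> 0), 1, 1; split => // T T' XT; case: noT; exists T.
have [D [r0 [D1 r0b sD sr]]] := tile_bounds (A := A).
have [r00 r01] := andP r0b; have D0 : 0 < D := lt_le_trans ltr01 D1.
have [C [B [B0 codeP]]] := local_code D1 r0b sD sr prim flc T0O.
have [c [a [c0 a1 rep]]] := repulsion D1 r0b sD sr prim flc T0O aper.
have a0 : 0 < a := lt_le_trans ltr01 a1.
(* The factor [d%:R] turns the sup-norm radius of [repulsion] into a Euclidean radius of
   agreement. *)
pose a' := d%:R * a.
have a'1 : 1 <= a' by rewrite mulr_ege1// ler1n.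
have a'0 : 0 < a' := lt_le_trans ltr01 a'1.
(* Ensures [B * rad n / mesh n <= H * L] at all levels: [2 / r0] serves level 0, the other summand
   the later ones. *)
pose H := B * (a' + D) * (2 / r0 + 1 / (c * a)).
have X0 : 0 < B * (a' + D) by rewrite mulr_gt0// addr_gt0.
have u0 : 0 <= 2 / r0 by rewrite divr_ge0// ltW.
have v0 : 0 <= 1 / (c * a) by rewrite divr_ge0// ltW// mulr_gt0.
have H0 : 0 <= H by rewrite mulr_ge0 ?addr_ge0// ltW.
pose Z := Num.bound H.
have HZ : H < Z%:R := archi_boundP H0.
have Z0 : (0 < Z)%N by rewrite -(ltr0n R) (le_lt_trans H0).
(* Chosen so that the codes number exactly C.+1 * (Z * 4K)^d = K^(d+1). *)
pose K := (C.+1 * (4 * Z) ^ d)%N.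
have K0 : (0 < K)%N by rewrite muln_gt0/= expn_gt0 muln_gt0 Z0.
pose L : R := (4 * K)%:R; have L1 : 1 <= L by rewrite ler1n muln_gt0 K0.
have L0 : 0 < L := lt_le_trans ltr01 L1.
have Ln1 n : 1 <= L ^+ n by rewrite exprn_ege1.
have Ln0 n : 0 < L ^+ n := lt_le_trans ltr01 (Ln1 n).
pose G := (Z * (4 * K)).-1.
have GE : G.+1 = (Z * (4 * K))%N by rewrite prednK// muln_gt0 Z0 muln_gt0 K0.
(* The summand [D] is the loss in [mem_agree_on_ball]. *)
pose rad n := a' * L ^+ n + D.
(* Each mesh forces a zero shift: below the separation [r0] at level 0, within the repulsion range
   for radius [a * L ^+ m] afterwards. *)
pose mesh n := if n is m.+1 then c * (a * L ^+ m) else r0 / 2.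
have mesh0 n : 0 < mesh n.
  by case: n => [|n]; rewrite /mesh ?divr_gt0// !mulr_gt0.
have rad1 n : 1 <= rad n.
  by rewrite /rad ler_wpDr ?(ltW D0)// mulr_ege1.
have meshG n : B * rad n / mesh n < G.+1%:R.
  have radL : rad n <= (a' + D) * L ^+ n.
    by rewrite mulrDl lerD2l ler_peMr// ltW.
  apply: (@le_lt_trans _ _ (H * L)); last by rewrite GE natrM ltr_pM2r.
  apply: (@le_trans _ _ (B * ((a' + D) * L ^+ n) / mesh n)).
    by rewrite ler_pM2r ?invr_gt0// ler_pM2l.
  have -> : B * ((a' + D) * L ^+ n) / mesh n = B * (a' + D) * (L ^+ n / mesh n).
    by rewrite !mulrA.
  rewrite /H -[B * (a' + D) * _ * L]mulrA ler_pM2l//.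
  case: n {radL} => [|n]; rewrite /mesh.
    rewrite expr0 invf_div mul1r; apply: (@le_trans _ _ (2 / r0 + 1 / (c * a))).
      by rewrite lerDl.
    by rewrite ler_peMr// addr_ge0.
  have -> : L ^+ n.+1 / (c * (a * L ^+ n)) = 1 / (c * a) * L.
    by rewrite exprS; field; rewrite !gt_eqF.
  by rewrite ler_pM2r// lerDr.
have codes n : exists code : set (tile A) -> 'I_C.+1 * {ffun 'I_d -> 'I_G.+1},
    forall T1 T2, tiling_space w T1 -> tiling_space w T2 -> code T1 = code T2 ->
    exists x, [/\ `|x| <= mesh n,
      forall t, T1 t -> `|t.2| <= rad n -> T2 (t.1, t.2 + x) &
      forall t, T2 t -> `|t.2| <= rad n -> T1 (t.1, t.2 - x)].
  exact: codeP.
have [code {}codeP] := choice codes.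
(* Levels are shifted by one, so that [E 0] is trivial and [code n] refines [E n] into [E n.+1]. *)
pose E n (T1 T2 : set (tile A)) :=
  if n is m.+1 then agree_on_ball T1 T2 (a' * L ^+ m) else True.
have Emono m T1 T2 : E m.+1 T1 T2 -> E m T1 T2.
  case: m => // m; apply: agree_on_ball_mono.
  by rewrite exprS mulrCA ler_peMl// mulr_ge0// ltW.
have Estep m T1 T2 : canonical_transversal w T1 -> canonical_transversal w T2 ->
    E m T1 T2 -> code m T1 = code m T2 -> E m.+1 T1 T2.
  move=> [T1O [t1 Tt1 t10]] [T2O [t2 Tt2 t20]] ET /(codeP m _ _ T1O T2O)[x [xm T12 T21]].
  rewrite /puncture in t10 t20; suff x0 : x = 0.
    apply: (mem_agree_on_ball sD) => t tm; split=> Tt.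
      by have := T12 t Tt tm; rewrite x0 addr0 -surjective_pairing.
    by have := T21 t Tt tm; rewrite x0 subr0 -surjective_pairing.
  (* Without agreement (level 0), the tiles at the origin force [x = 0]. *)
  case: m ET xm T12 {T21} => [_ xm T12|m ET xm T12].
    have [[PT2 _] _] := T2O.
    have T2x : T2 (t1.1, t1.2 + x).
      by apply: T12 => //; rewrite t10 normr0 (le_trans ler01).
    have t12 : (t1.1, t1.2 + x) = t2.
      apply: (punctures_separated r0b sr PT2 T2x Tt2) => /=.
      rewrite t10 t20 add0r subr0.
      by apply: le_lt_trans xm _; rewrite ltr_pdivrMr// ltr_pMr// ltr1n.
    by move: t20; rewrite -t12 /= t10 add0r.
  (* A tile of [T2] near the origin lies in [T1] by agreement, and its shift by [x] is back in [T2]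
     by the equality of codes. *)
  apply: (rep T2 (a * L ^+ m)) => //; first by rewrite ler_peMr// ltW.
  move=> t Tt tm; apply: T12.
    apply: (agree_on_ball_mem r00 sr (esym ET) Tt).
    by rewrite /a' -mulrA ler_wpM2l.
  apply: le_trans tm _; rewrite /rad ler_wpDr ?(ltW D0)//.
  apply: (@le_trans _ _ (a' * L ^+ m)).
    by rewrite ler_pM2r// ler_peMl ?(ltW a0)// ler1n.
  by rewrite ler_pM2l// exprS ler_peMl// ltW.
have cardI : (#|[the finType of ('I_C.+1 * {ffun 'I_d -> 'I_G.+1})%type]| <= K ^ d.+1)%N.
  rewrite card_prod card_ffun !card_ord GE mulnA [(Z * 4)%N]mulnC expnMn mulnA.
  by rewrite -/K expnS.
have [|||F FP] := @nested_equivalence_embedding R _ (canonical_transversal w) E _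
  d.+1 K code K0 cardI _ _ _ Emono Estep.
- by case.
- by case=> // m T1 T2 /esym.
- by case=> // m T1 T2 T3; exact: etrans.
have q0 : 0 < digit_ratio K :> R := digit_ratio_gt0 K0.
have qL m : digit_ratio K ^+ m = (L ^+ m)^-1 :> R by rewrite exprVn.
pose cp := d.+1%:R * (2 * K%:R) * (1 + a').
exists F, (1 / (2 * L)), cp; split.
- by rewrite divr_gt0// mulr_gt0.
- apply: (@le_trans _ _ 1).
    by rewrite ler_pdivrMr ?mulr_gt0// mul1r mulr_ege1// ler1n.
  by rewrite /cp !mulr_ege1// ?ler1n// lerDl ltW.
move=> T T' TX T'X; have [<-|TT'] := pselect (T = T').
  rewrite /rho; case: asboolP => // _; rewrite subrr !mulr0 /enorm.
  by rewrite big1 ?sqrtr0 ?lexx// => i _; rewrite mxE expr0n.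
(* As [1 < L], the balls of agreement exhaust the space, so agreement at all levels would mean
   equality. *)
have [n nE] : exists n, ~ E n T T'.
  apply: contrapT => /forallNP allE; apply: TT'.
  have agr m : agree_on_ball T T' (a' * L ^+ m) := contrapT (allE m.+1).
  have L1' : 1 < L by rewrite ltr1n (leq_trans _ (leq_pmulr 4 K0)).
  have half (T1 T2 : set (tile A)) :
      (forall m, agree_on_ball T1 T2 (a' * L ^+ m)) -> T1 `<=` T2.
    move=> agr12 t Tt; have [m tm] := expr_unbounded `|t.2| L1'.
    apply: (agree_on_ball_mem r00 sr (agr12 m) Tt).
    by rewrite /a' -mulrA ler_wpM2l// (le_trans tm)// ler_peMl// ltW.
  by apply/seteqP; split; apply: half => // m; exact/esym/agr.
have exn : exists n, `[< ~ E n T T' >] by exists n; apply/asboolP.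
(* The first separating level is [m.+1], as level 0 separates nothing. *)
case: (ex_minnP exn) => -[/asboolP[]//|m] /asboolP nEm minm.
have Em : E m T T'.
  apply: contrapT => /asboolP /minm; by rewrite ltnn.
have /andP[Fge Fle] := FP m T T' TX T'X Em nEm.
have aL0 : 0 <= a' * L ^+ m by rewrite mulr_ge0// ltW.
have [/andP[rge r1] rle] := rho_bounds TT' aL0 nEm.
rewrite qL in Fge Fle; apply/andP; split.
  apply: le_trans Fge.
  (* For [m = 0] this is [rho <= 1 <= L]; otherwise agreement holds one level earlier, at the cost
     of a factor [L] that enters the lower constant. *)
  have : rho T T' <= L / L ^+ m.
    case: m Em {nEm minm Fle aL0 rge} => [_|m Em].
      by rewrite expr0 divr1 (le_trans r1).
    have aL0 : 0 <= a' * L ^+ m by rewrite mulr_ge0// ltW.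
    apply: le_trans (rle _ aL0 Em) _.
    rewrite exprS invfM mulrA divff ?gt_eqF// mul1r div1r.
    rewrite lef_pV2 ?posrE ?ltr_pwDl// ler_wpDl// ler_peMl// ltW//.
  move=> rhoL; rewrite div1r invfM -mulrA [_^-1 * 2^-1]mulrC ler_pM2l//.
  by rewrite ler_pdivrMl.
apply: le_trans Fle _; rewrite /cp -!mulrA ler_pM2l// ler_pM2l// ler_pM2l ?ltr0n//.
(* Since [1 <= L ^+ m], the sum [1 + a' * L ^+ m] is at most [(1 + a') * L ^+ m]; this is the factor
   [1 + a'] of [cp]. *)
apply: le_trans (_ : (1 + a') * (1 / (1 + a' * L ^+ m)) <= _); last first.
  by rewrite ler_pM2l// addr_gt0.
rewrite div1r ler_pdivlMr ?ltr_pwDl// mulrDr mulr1 mulrCA mulVf ?gt_eqF// mulr1.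
by rewrite lerD2r invf_le1.
Qed.
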